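(* In the binary-state, binary-action model described in the context, there are real constants $w_i$ and $\eta_i$, $i\in[n]$, completely determined by the initial priors and signal structures of agent $i$ and her neighbors (in particular not depending on the realized signals), such that for every $i\in[n]$ the Bayesian action of agent $i$ at time one, following her observations of the actions of her neighbors at time zero and of her own private signal at time zero, is given by $$\mathbf{a}_{i,1}=\operatorname{sign}\Big(\sum_{j\in\mathcal{N}(i)}w_j\,\mathbf{a}_{j,0}+\eta_i+\lambda_1(\mathbf{s}_{i,0})\Big).$$
   Context: There are $n$ agents labeled by $[n]=\{1,\dots,n\}$ interacting on a directed graph $([n],\mathcal{E})$; $\mathcal{N}(i)=\{j\in[n]:(j,i)\in\mathcal{E}\}$ is the neighborhood of $i$, with $i\notin\mathcal{N}(i)$. The state space is $\Theta=\{+1,-1\}$; the true state is $\theta=-1$. Each agent $i$ has a finite signal space $\mathcal{S}_i$, probability mass functions $\ell_i(\cdot\mid\hat\theta)$, $\hat\theta\in\Theta$, on $\mathcal{S}_i$ with $\ell_i(s\mid\hat\theta)>0$ for all $s\in\mathcal{S}_i$, and a prior $\nu_i$ on $\Theta$ with $\nu_i(\pm1)>0$. Priors and signal structures are common knowledge. Conditionally on the state being $\hat\theta$, the time-zero signals $\mathbf{s}_{i,0}$, $i\in[n]$, are independent with $\mathbf{s}_{i,0}\sim\ell_i(\cdot\mid\hat\theta)$. For $s\in\mathcal{S}_i$ write $\lambda_1(s)=\log\big(\ell_i(s\mid+1)/\ell_i(s\mid-1)\big)$. All agents have action space $\{-1,1\}$ and utility $u_i(a,\hat\theta)=1$ if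 $a=\hat\theta$ and $-1$ otherwise. At time $0$ agent $i$ forms the posterior $\mu_{i,0}(\hat\theta)=\nu_i(\hat\theta)\ell_i(\mathbf{s}_{i,0}\mid\hat\theta)/\sum_{\tilde\theta\in\Theta}\nu_i(\tilde\theta)\ell_i(\mathbf{s}_{i,0}\mid\tilde\theta)$ and takes an action $\mathbf{a}_{i,0}$ maximizing $\sum_{\hat\theta}u_i(a,\hat\theta)\mu_{i,0}(\hat\theta)$ over $a\in\{-1,1\}$. At time $1$, $\mu_{i,1}$ is the Bayesian posterior of agent $i$ on $\Theta$, computed with her prior $\nu_i$ and the signal likelihoods of all agents, conditional on $\mathbf{s}_{i,0}$ and on the observed actions $\mathbf{a}_{j,0}$, $j\in\mathcal{N}(i)$ (knowing that each $\mathbf{a}_{j,0}$ was produced from $\mathbf{s}_{j,0}$ by the time-zero rule with prior $\nu_j$). The Bayesian action $\mathbf{a}_{i,1}$ maximizes $\sum_{\hat\theta}u_i(a,\hat\theta)\mu_{i,1}(\hat\theta)$ over $a\in\{-1,1\}$; no new signal is received at time $1$. In case of indifference agents choose $+1$, and correspondingly $\operatorname{sign}(x)=+1$ for $x\ge0$ and $\operatorname{sign}(x)=-1$ for $x<0$. *)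

(* Defs.v *)
From mathcomp Require Import all_boot all_order all_algebra.
From mathcomp Require Import reals exp.
Set Implicit Arguments.
Unset Strict Implicit.
Unset Printing Implicit Defensive.
Import Order.TTheory GRing.Theory Num.Theory.
Local Open Scope ring_scope.

(* States and actions both range over {+1,-1}; true encodes +1, false -1. *)
Definition pm1 := bool.

Definition pm1_val (R : realType) (a : pm1) : R := if a then 1 else -1.

(* Unlike Num.sg, takes the value +1 at 0. *)
Definition sgn (R : realType) (x : R) : R := if 0 <= x then 1 else -1.

(* lik th s is the probability of signal s when the state is th. *)
Record agent (R : realType) := Agent {
  signal : finType;
  lik : pm1 -> signal -> R;
  prior : pm1 -> R;
  lik_gt0 : forall th s, 0 < lik th s;
  lik_sum1 : forall th, \sum_s lik th s = 1;
  prior_gt0 : forall th, 0 < prior th;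
  prior_sum1 : \sum_th prior th = 1
}.

Definition lambda1 (R : realType) (x : agent R) (s : signal x) : R :=
  ln (lik true s / lik false s).

Definition utility (R : realType) (a th : pm1) : R :=
  if a == th then 1 else -1.

Definition expected_utility (R : realType) (mu : pm1 -> R) (a : pm1) : R :=
  \sum_(th : pm1) utility R a th * mu th.

(* The maximizer of the expected utility over the two actions; the large
   inequality breaks ties in favour of +1. *)
Definition optimal_action (R : realType) (mu : pm1 -> R) : pm1 :=
  if expected_utility mu false <= expected_utility mu true then true else false.

Definition posterior0 (R : realType) (x : agent R) (s : signal x) (th : pm1) : R :=
  prior x th * lik th s / \sum_(th' : pm1) prior x th' * lik th' s.

Definition action0 (R : realType) (x : agent R) (s : signal x) : pm1 :=
  optimal_action (posterior0 s).

(* E j i is the edge (j, i): agent i observes agent j. *)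
Definition nbhd (n : nat) (E : rel 'I_n) (i : 'I_n) : {set 'I_n} :=
  [set j | E j i].

Definition nbhd_agents (R : realType) (n : nat) (E : rel 'I_n)
    (A : 'I_n -> agent R) (i : 'I_n) : seq (agent R) :=
  [seq A j | j <- enum (nbhd E i)].

Definition profile (R : realType) (n : nat) (A : 'I_n -> agent R) : finType :=
  {dffun forall j : 'I_n, signal (A j)}.

(* The joint law of the state and the signals under the prior of agent i: the
   signals are independent conditionally on the state. *)
Definition joint (R : realType) (n : nat) (A : 'I_n -> agent R) (i : 'I_n)
    (th : pm1) (t : profile A) : R :=
  prior (A i) th * \prod_(j < n) lik th (t j).

(* What agent i knows at time one when the realized signals are s: the profiles
   giving her the same signal and her neighbors the same time-zero actions. *)
Definition info (R : realType) (n : nat) (E : rel 'I_n) (A : 'I_n -> agent R)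
    (i : 'I_n) (s : profile A) : {set profile A} :=
  [set t : profile A | (t i == s i) &&
     [forall j in nbhd E i, action0 (t j) == action0 (s j)]].

(* The conditioning event contains s, so its probability is positive. *)
Definition posterior1 (R : realType) (n : nat) (E : rel 'I_n)
    (A : 'I_n -> agent R) (i : 'I_n) (s : profile A) (th : pm1) : R :=
  (\sum_(t in info E i s) joint i th t)
  / \sum_(th' : pm1) \sum_(t in info E i s) joint i th' t.

Definition action1 (R : realType) (n : nat) (E : rel 'I_n)
    (A : 'I_n -> agent R) (i : 'I_n) (s : profile A) : pm1 :=
  optimal_action (posterior1 E i s).

(* Main.v *)
Require Import Defs.
From mathcomp Require Import all_boot all_order all_algebra.
From mathcomp Require Import reals exp ring lra.
Set Implicit Arguments.
Unset Strict Implicit.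
Unset Printing Implicit Defensive.
Import Order.TTheory GRing.Theory Num.Theory.
Local Open Scope ring_scope.

(* The joint likelihood of agent i's signal and of the actions she observes is a
   product over agents, so her log-posterior ratio is log-prior ratio
   + lambda1 (s i) + the sum over her neighbors j of the log-likelihood ratio
   r_j(a_j) of the observed action. A function of a in {+1,-1} is affine:
   r(a) = (r(1) - r(-1))/2 * a + (r(1) + r(-1))/2; the slopes are the weights w_j,
   and the intercepts together with the log-prior ratio make up eta_i. *)

(** Dependent functions are traded for [fprod T]: functions into the tagged union of the [T i] whose
    value at [i] has tag [i]. Distributivity for a fixed codomain then applies. *)
Lemma prod_sum_dffun (R : comNzSemiRingType) (I : finType) (T : I -> finType)
    (F : forall i, T i -> R) :
  \prod_i \sum_(u : T i) F i u =
  \sum_(t : {dffun forall i, T i}) \prod_i F i (t i).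
Proof.
pose P i : {ffun T i -> R} := [ffun u => F i u].
rewrite (reindex (@dffun_of_fprod _ T)); last first.
  exact/onW_bij/dffun_of_fprod_bij.
transitivity (\sum_(t : fprod T) \prod_(i in I) P i (t i)).
  rewrite (@big_fprod _ 0 1 *%R +%R).
  rewrite -(bigA_distr_big_dep (tagged_with T) (fun i => untag 0 (P i))).
  apply: eq_bigr => i _; rewrite -(big_tag (fun i => P i)).
  by apply: eq_bigr => u _; rewrite ffunE.
by apply: eq_bigr => t _; apply: eq_bigr => i _; rewrite !ffunE.
Qed.

(** Each condition becomes a zero value of its factor, so violating a single one kills the whole
    product. *)
Lemma prod_sum_dffun_cond (R : comNzSemiRingType) (I : finType)
    (T : I -> finType) (Q : forall i, pred (T i)) (F : forall i, T i -> R) :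
  \prod_i \sum_(u : T i | Q i u) F i u =
  \sum_(t : {dffun forall i, T i} | [forall i, Q i (t i)]) \prod_i F i (t i).
Proof.
under eq_bigr do rewrite big_mkcond.
rewrite prod_sum_dffun [RHS]big_mkcond; apply: eq_bigr => t _.
case: ifPn => [/forallP Qt|/forallPn[i /negPf nQ]].
  by apply: eq_bigr => i _; rewrite Qt.
by rewrite (bigD1 i) //= nQ mul0r.
Qed.

Lemma optimal_actionE (R : realType) (mu : pm1 -> R) :
  optimal_action mu = (mu false <= mu true).
Proof.
rewrite /optimal_action /expected_utility !big_bool /utility /=.
rewrite !mul1r !mulN1r.
by case: (leP (mu false)) => h; case: leP => // h'; exfalso; lra.
Qed.

Section LogLikelihoodRatio.
Variable R : realType.

Definition action_lik (x : agent R) (a th : pm1) : R :=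
  \sum_(s : signal x | action0 s == a) lik th s.

(* If a is never chosen by x this is ln (0 / 0) = ln 0 = 0; it is then never
   observed. *)
Definition action_llr (x : agent R) (a : pm1) : R :=
  ln (action_lik x a true / action_lik x a false).

Definition llr_slope (x : agent R) : R :=
  (action_llr x true - action_llr x false) / 2.

Definition llr_intercept (x : agent R) : R :=
  (action_llr x true + action_llr x false) / 2.

Lemma action_llr_affine (x : agent R) (a : pm1) :
  action_llr x a = llr_slope x * pm1_val R a + llr_intercept x.
Proof. by rewrite /llr_slope /llr_intercept; case: a => /=; lra. Qed.

(** The term of [s] itself is positive. An action triggered by no signal would have likelihood 0. *)
Lemma action_lik_gt0 (x : agent R) (s : signal x) th :
  0 < action_lik x (action0 s) th.
Proof.
rewrite /action_lik (bigD1 s) //= ltr_wpDr ?lik_gt0 //.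
by apply: sumr_ge0 => u _; rewrite ltW ?lik_gt0.
Qed.

Lemma ln_prod (I : Type) (r : seq I) (P : pred I) (F : I -> R) :
  (forall i, P i -> 0 < F i) ->
  ln (\prod_(i <- r | P i) F i) = \sum_(i <- r | P i) ln (F i).
Proof.
(* Positivity of the partial products is carried along the induction because [lnM] requires it. *)
move=> F_gt0; suff [] : 0 < \prod_(i <- r | P i) F i /\
  ln (\prod_(i <- r | P i) F i) = \sum_(i <- r | P i) ln (F i) by [].
elim/big_rec2: _ => [|i y z Pi [z_gt0 <-]]; first by rewrite ln1.
by rewrite mulr_gt0 ?F_gt0 // lnM // posrE F_gt0.
Qed.

Variables (n : nat) (E : rel 'I_n) (A : 'I_n -> agent R) (i : 'I_n).
Hypothesis irrE : irreflexive E.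

(** The information event is a rectangle, one condition per agent, so the sum of products factors
    over agents. *)
Lemma sum_joint_info (s : profile A) th :
  \sum_(t in info E i s) joint i th t =
  prior (A i) th * lik th (s i) *
  \prod_(j in nbhd E i) action_lik (A j) (action0 (s j)) th.
Proof.
have iN : i \notin nbhd E i by rewrite inE irrE.
(* By irreflexivity [i] is not her own neighbor, so her coordinate carries only the equality of
   signals; unobserved agents get a true condition. *)
pose Q j (u : signal (A j)) :=
  if j == i then u == s j else (j \in nbhd E i) ==> (action0 u == action0 (s j)).
transitivity (prior (A i) th * \prod_j \sum_(u | Q j u) lik th u).
  rewrite prod_sum_dffun_cond mulr_sumr; apply: eq_bigl => t.
  rewrite inE; apply/andP/forallP => [[/eqP ti /forallP h] j|h].
    by rewrite /Q; case: eqP => [->|_]; [apply/eqP|exact: h].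
  split; first by have := h i; rewrite /Q eqxx.
  apply/forallP => j; have := h j; rewrite /Q; case: eqP => // -> _.
  by rewrite (negPf iN).
rewrite -mulrA (bigD1 i) //= {1}/Q eqxx big_pred1_eq.
(* The factor of an unobserved agent is the sum of [lik th] over all her signals, which is 1. *)
congr (_ * (_ * _)); rewrite (bigID (mem (nbhd E i))) /= mulrC big1 ?mul1r.
  apply: eq_big => [j|j /andP[/negPf ji jN]].
    by case: eqVneq => //= ->; rewrite (negPf iN).
  by apply: eq_bigl => u; rewrite /Q ji jN.
move=> j /andP[/negPf ji /negPf jN]; rewrite -[RHS](lik_sum1 (A j) th).
by apply: eq_bigl => u; rewrite /Q ji jN.
Qed.

Lemma sum_joint_info_gt0 (s : profile A) th :
  0 < \sum_(t in info E i s) joint i th t.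
Proof.
rewrite sum_joint_info !mulr_gt0 ?prior_gt0 ?lik_gt0 ?prodr_gt0 //.
by move=> j _; exact: action_lik_gt0.
Qed.

Lemma ln_ratio_sum_joint_info (s : profile A) :
  ln ((\sum_(t in info E i s) joint i true t)
      / \sum_(t in info E i s) joint i false t) =
  \sum_(j in nbhd E i) action_llr (A j) (action0 (s j))
  + ln (prior (A i) true / prior (A i) false) + lambda1 (s i).
Proof.
rewrite !sum_joint_info.
have p_gt0 th : 0 < prior (A i) th := prior_gt0 (A i) th.
have l_gt0 th : 0 < lik th (s i) := lik_gt0 th (s i).
have a_gt0 j th := action_lik_gt0 (s j) th.
under eq_bigr => j _ do rewrite /action_llr.
rewrite -ln_prod; last by move=> j _; rewrite divr_gt0.
have P_gt0 th : 0 < \prod_(j in nbhd E i) action_lik (A j) (action0 (s j)) th.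
  by rewrite prodr_gt0.
rewrite prodf_div /lambda1 -!lnM ?posrE ?(divr_gt0, mulr_gt0) //.
by congr ln; field; rewrite !gt_eqF.
Qed.

(** The positive normalizing constant cancels. The large inequality survives the logarithm, so ties
    match the value of [sgn] at 0. *)
Lemma action1E (s : profile A) :
  action1 E i s = (0 <= ln ((\sum_(t in info E i s) joint i true t)
                            / \sum_(t in info E i s) joint i false t)).
Proof.
have N_gt0 := sum_joint_info_gt0 s.
rewrite /action1 optimal_actionE /posterior1 ler_pM2r; last first.
  by rewrite invr_gt0 big_bool addr_gt0.
by rewrite ln_div ?posrE // subr_ge0 ler_ln ?posrE.
Qed.

End LogLikelihoodRatio.

Theorem lemma1 (R : realType) :
  exists W H : agent R -> seq (agent R) -> R,
  forall (n : nat) (E : rel 'I_n) (A : 'I_n -> agent R),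
    irreflexive E ->
    let w (i : 'I_n) := W (A i) (nbhd_agents E A i) in
    let eta (i : 'I_n) := H (A i) (nbhd_agents E A i) in
    forall (i : 'I_n) (s : profile A),
      pm1_val R (action1 E i s) =
      sgn (\sum_(j in nbhd E i) w j * pm1_val R (action0 (s j))
           + eta i + lambda1 (s i)).
Proof.
(* The weight of an agent depends on her alone, whoever observes her; the neighbors enter only
   through the intercepts in [eta]. *)
exists (fun x _ => llr_slope x).
exists (fun x ys => \sum_(y <- ys) llr_intercept y
                    + ln (prior x true / prior x false)).
move=> n E A irrE w eta i s.
rewrite action1E // ln_ratio_sum_joint_info // /pm1_val /sgn /eta.
rewrite /nbhd_agents big_map big_enum addrA -big_split /=.
by under eq_bigr do rewrite action_llr_affine.
Qed.
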